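(* For every dimension $d\ge 2$ there exist constants $a_d,A_d>0$ and an integer $T'_d$, depending only on $d$, such that for every $\delta>0$ and every integer $T> T'_d$, \[ \delta\cdot 2^{-2^{A_d T}}\;\le\;\mathsf{ExcessErr}_d(T,\delta)\;\le\;\delta\cdot 2^{-2^{a_d T}} . \]
   Context: Linear reconstruction game: fix $d\ge 1$, a number of rounds $T\ge 0$ and a noise level $\delta>0$. An adversary holds a secret point $x^*\in\mathbb{R}^d$. In each round $t=1,\dots,T$ the reconstructor chooses a unit vector $v_t\in S^{d-1}$ (possibly adaptively, as a function of previous answers) and the adversary returns a real number $r_t$ with $|r_t-\langle x^*,v_t\rangle|\le\delta$. After $T$ rounds the reconstructor outputs $\hat x_T\in\mathbb{R}^d$. All strategies are deterministic. The optimal reconstruction error is $\mathrm{OPT}_d(T,\delta)=\inf_{\mathcal R}\sup_{x^*\in\mathbb{R}^d}\sup_{\mathcal A}\|\hat x_T-x^*\|_2$, where $\mathcal R$ ranges over reconstructor strategies for $T$ rounds and $\mathcal A$ over adversary answer strategies satisfying the noise constraint for the secret $x^*$. This quantity is nonincreasing in $T$; set $\mathrm{OPT}_d(\infty,\delta):=\lim_{T\to\infty}\mathrm{OPT}_d(T,\delta)$ and $\mathsf{ExcessErr}_d(T,\delta):=\mathrm{OPT}_d(T,\delta)-\mathrm{OPT}_d(\infty,\delta)$. *)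

(* Defs.v *)
From HB Require Import structures.
From mathcomp Require Import all_boot all_order all_algebra.
From mathcomp Require Import all_classical all_reals all_analysis.
Set Implicit Arguments. Unset Strict Implicit. Unset Printing Implicit Defensive.
Import Order.TTheory GRing.Theory Num.Theory.
Local Open Scope classical_set_scope.
Local Open Scope ring_scope.

Section Game.
Variables (R : realType) (d : nat).

Definition dotv (x v : 'rV[R]_d) : R := \sum_(i < d) x 0 i * v 0 i.
Definition eucl (x : 'rV[R]_d) : R := Num.sqrt (dotv x x).

(* A deterministic reconstructor: the query of round t+1 is a function of
   the answers r_1..r_t received so far (it knows its own previous queries,
   being deterministic); queries lie on the unit sphere S^{d-1}; after T
   rounds the output is a function of the T answers. *)
Record recon := Recon {
  rquery : seq R -> 'rV[R]_d ;
  rquery_unit : forall s, dotv (rquery s) (rquery s) = 1 ;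
  routput : seq R -> 'rV[R]_d }.

Definition adversary := seq ('rV[R]_d * R) -> 'rV[R]_d -> R.

Definition valid_adv (delta : R) (x : 'rV[R]_d) (A : adversary) :=
  forall h v, `| A h v - dotv x v | <= delta.

Definition play (Rc : recon) (A : adversary) (T : nat) : seq ('rV[R]_d * R) :=
  iter T (fun h => let v := rquery Rc (map snd h) in rcons h (v, A h v)) [::].

Definition recon_err (Rc : recon) (A : adversary) (x : 'rV[R]_d) (T : nat) : R :=
  eucl (routput Rc (map snd (play Rc A T)) - x).

Definition OPT (T : nat) (delta : R) : \bar R :=
  ereal_inf [set ereal_sup [set (recon_err Rc xA.2 xA.1 T)%:E
                           | xA in [set xA : 'rV[R]_d * adversary
                                    | valid_adv delta xA.1 xA.2]]
            | Rc in [set: recon]].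

Definition OPT_inf (delta : R) : \bar R := limn (fun T => OPT T delta).

Definition ExcessErr (T : nat) (delta : R) : \bar R :=
  (OPT T delta - OPT_inf delta)%E.

End Game.

(* Main.v *)
(** The limit error is [delta * J] with [J = sqrt (2 d / (d + 1))], the radius
    in Jung's theorem for diameter 2: points that can never be separated are at
    distance at most [2 delta], and a regular simplex of edge [2 delta] is never
    separated.

    Upper bound. By duality the circumradius of the set [K] of consistent points
    is the supremum of the standard deviations of weighted [d + 1]-point
    configurations in [K], so only configurations of variance above [J ^ 2]
    ("excessive" ones) count. Suppose every excessive configuration lies within
    [eta] of one of finitely many reference simplices, and query all the edge
    directions of these. Two excessive configurations near the same reference
    then have all their cross distances at most [sqrt (4 + 4 eta ^ 2)], since only
    the transversal part of a difference, of size [2 eta], escapes the query.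
    Being of variance above [J ^ 2] they are regular up to [O(eta ^ 2)], and two
    such simplices that are close and cross-bounded differ by [O(eta ^ 2)] only.
    Hence a bounded number of queries replaces [eta] by [O(eta ^ 2)].

    Lower bound. The adversary keeps a regular simplex of edge slightly above 2
    whose vertices are centres of balls of radius [eta] contained in [K]. At most
    one edge is nearly parallel to the query; rotating the simplex by an angle of
    order [eta] shortens its projection by order [eta ^ 2], so that the simplex
    survives with balls of radius [eta ^ 2 / 512]. *)
Require Import Defs.
From HB Require Import structures.
From mathcomp Require Import all_boot all_order all_algebra.
From mathcomp Require Import all_classical all_reals all_analysis.
From mathcomp Require Import ring lra zify.
Import Order.TTheory GRing.Theory Num.Theory.
Import numFieldNormedType.Exports.
Local Open Scope ring_scope.

Set Implicit Arguments.
Unset Strict Implicit.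
Unset Printing Implicit Defensive.

(** * The scalar product on row vectors *)

Section DotProduct.
Variables (R : realType) (d : nat).
Implicit Types (x y z v w : 'rV[R]_d) (a : R).

Lemma dotvC x y : dotv x y = dotv y x.
Proof. by apply: eq_bigr => i _; rewrite mulrC. Qed.

Lemma dotvDl x y z : dotv (x + y) z = dotv x z + dotv y z.
Proof. by rewrite /dotv -big_split; apply: eq_bigr => i _; rewrite mxE mulrDl. Qed.

Lemma dotvZl a x z : dotv (a *: x) z = a * dotv x z.
Proof. by rewrite /dotv mulr_sumr; apply: eq_bigr => i _; rewrite mxE mulrA. Qed.

Lemma dotvNl x z : dotv (- x) z = - dotv x z.
Proof. by rewrite -scaleN1r dotvZl mulN1r. Qed.

Lemma dotvDr x y z : dotv z (x + y) = dotv z x + dotv z y.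
Proof. by rewrite dotvC dotvDl !(dotvC z). Qed.

Lemma dotvZr a x z : dotv z (a *: x) = a * dotv z x.
Proof. by rewrite dotvC dotvZl (dotvC z). Qed.

Lemma dotvNr x z : dotv z (- x) = - dotv z x.
Proof. by rewrite dotvC dotvNl (dotvC z). Qed.

Definition dotvE := (dotvDl, dotvDr, dotvNl, dotvNr, dotvZl, dotvZr).

Lemma dotv0l x : dotv 0 x = 0.
Proof. by rewrite -(scale0r x) dotvZl mul0r. Qed.

Lemma dotv_suml (I : finType) (F : I -> 'rV[R]_d) z :
  dotv (\sum_i F i) z = \sum_i dotv (F i) z.
Proof.
apply: (big_morph (fun x => dotv x z)) => [x y|]; first exact: dotvDl.
exact: dotv0l.
Qed.

Lemma dotv_ge0 x : 0 <= dotv x x.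
Proof. by apply: sumr_ge0 => i _; rewrite -expr2 sqr_ge0. Qed.

Lemma dotv_eq0 x : dotv x x = 0 -> x = 0.
Proof.
move=> /eqP; rewrite psumr_eq0 => [/allP h|i _]; last by rewrite -expr2 sqr_ge0.
apply/rowP => i; rewrite mxE; apply/eqP.
by have := h i (mem_index_enum _); rewrite -expr2 sqrf_eq0.
Qed.

Lemma dotv_sqrD x y :
  dotv (x + y) (x + y) = dotv x x + 2 * dotv x y + dotv y y.
Proof. by rewrite !dotvE (dotvC y x); ring. Qed.

Lemma dotv_sqrB_le x y : dotv (x - y) (x - y) <= 2 * dotv x x + 2 * dotv y y.
Proof.
have := dotv_ge0 (x + y); rewrite !dotvE (dotvC y x); lra.
Qed.

Lemma dotv_sqrD_le x y : dotv (x + y) (x + y) <= 2 * dotv x x + 2 * dotv y y.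
Proof.
have := dotv_ge0 (x - y); rewrite !dotvE (dotvC y x); lra.
Qed.

Lemma dotv_subC x y : dotv (x - y) (x - y) = dotv (y - x) (y - x).
Proof. by rewrite -opprB dotvNl dotvNr opprK. Qed.

(** Cauchy-Schwarz for a unit vector: the remainder of [x] after projection on [v] has a nonnegative
    square. *)
Lemma dotv_unit_sqr x v : dotv v v = 1 -> dotv x v ^+ 2 <= dotv x x.
Proof.
move=> v1; have := dotv_ge0 (x - dotv x v *: v).
by rewrite !dotvE v1 (dotvC v x); lra.
Qed.

Lemma eucl_le x a : 0 <= a -> (eucl x <= a) = (dotv x x <= a ^+ 2).
Proof.
move=> a0; rewrite /eucl -[in RHS](sqr_sqrtr (dotv_ge0 x)).
by rewrite ler_sqr // nnegrE sqrtr_ge0.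
Qed.

Lemma euclZ a x : 0 <= a -> eucl (a *: x) = a * eucl x.
Proof.
move=> a0; rewrite /eucl dotvZl dotvZr mulrA -expr2 sqrtrM ?sqr_ge0 //.
by rewrite sqrtr_sqr ger0_norm.
Qed.

Lemma dotv_delta x (i : 'I_d) : dotv x (delta_mx 0 i) = x 0 i.
Proof.
rewrite /dotv (bigD1 i) //= big1 => [|j ji]; rewrite mxE eqxx /=.
  by rewrite addr0 eqxx mulr1.
by rewrite (negbTE ji) mulr0.
Qed.

Lemma normalize_unit x : x != 0 -> exists2 v, dotv v v = 1 & exists2 a, 0 < a & x = a *: v.
Proof.
move=> x0; have xp : 0 < dotv x x.
  by rewrite lt0r dotv_ge0 andbT; apply: contra_neq x0 => /dotv_eq0.
have e0 : 0 < eucl x by rewrite sqrtr_gt0.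
exists ((eucl x)^-1 *: x); last first.
  by exists (eucl x) => //; rewrite scalerA divff ?scale1r // gt_eqF.
rewrite dotvZl dotvZr -(sqr_sqrtr (ltW xp)) -/(eucl x).
by field; rewrite gt_eqF.
Qed.

End DotProduct.

(** * The game as a recursion on the set of consistent secrets *)

Section GameValue.
Variables (R : realType) (d : nat).
Implicit Types (K : 'rV[R]_d -> Prop) (A : adversary R d) (Rc : recon R d).

(* [win delta r n K]: knowing that the secret lies in [K], the reconstructor
   can guarantee an error of at most [r] with [n] further queries. *)
Fixpoint win (delta r : R) (n : nat) K : Prop :=
  if n is n'.+1 then
    exists2 v, dotv v v = 1 &
      forall a, win delta r n' (fun x => K x /\ `|a - dotv x v| <= delta)
  else exists c, forall x, K x -> eucl (c - x) <= r.

Definition recon_after Rc (a : R) : recon R d :=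
  @Recon R d (fun s => rquery Rc (a :: s))
    (fun s => rquery_unit Rc (a :: s)) (fun s => routput Rc (a :: s)).

(** [play] grows a history at its end, whereas [win] peels off the first round; this converts one
    view into the other. *)
Lemma play_cons Rc A n (v := rquery Rc [::]) (a := A [::] v) :
  play Rc A n.+1 = (v, a) :: play (recon_after Rc a) (fun h => A ((v, a) :: h)) n.
Proof. by elim: n => [//|n IH]; rewrite {1}/play iterS -/(play Rc A n.+1) IH. Qed.

Lemma recon_err_cons Rc A x n (v := rquery Rc [::]) (a := A [::] v) :
  recon_err Rc A x n.+1 =
  recon_err (recon_after Rc a) (fun h => A ((v, a) :: h)) x n.
Proof. by rewrite /recon_err play_cons. Qed.

Lemma recon_err_ext Rc Rc' A x n :
  rquery Rc =1 rquery Rc' -> routput Rc =1 routput Rc' ->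
  recon_err Rc A x n = recon_err Rc' A x n.
Proof.
move=> eq_q eq_o; rewrite /recon_err eq_o; congr (eucl (routput _ (map _ _) - _)).
by apply: eq_iter => h; rewrite eq_q.
Qed.

Lemma exists_unit : (0 < d)%N -> exists v : 'rV[R]_d, dotv v v = 1.
Proof.
move=> d0; exists (delta_mx 0 (Ordinal d0)).
by rewrite dotv_delta mxE !eqxx.
Qed.

Lemma recon_of_win delta r n K : (0 < d)%N -> win delta r n K ->
  exists Rc, forall x A, K x -> valid_adv delta x A -> recon_err Rc A x n <= r.
Proof.
move=> d0; elim: n K => [K [c hc]|n IH K [v v1 hv]].
  have [v v1] := exists_unit d0.
  by exists (@Recon R d (fun=> v) (fun=> v1) (fun=> c)) => x A Kx _; exact: hc.
have [f hf] := choice (fun a => IH _ (hv a)).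
(* The first answer selects the strategy to continue with. In the output function below, [0] is only
   a default: after [n.+1] rounds the list of answers is nonempty. *)
pose q s := if s is a :: s' then rquery (f a) s' else v.
have q1 s : dotv (q s) (q s) = 1 by case: s => [|a s] //=; exact: rquery_unit.
exists (@Recon R d q q1 (fun s => if s is a :: s' then routput (f a) s' else 0)).
move=> x A Kx vA; rewrite recon_err_cons /=.
rewrite (@recon_err_ext _ (f (A [::] v))) //.
by apply: hf => [|h u]; [split => //; exact: vA | exact: vA].
Qed.

Lemma win_of_recon delta r n K Rc : 0 <= delta ->
  (forall x A, K x -> valid_adv delta x A -> recon_err Rc A x n <= r) ->
  win delta r n K.
Proof.
move=> delta0; elim: n K Rc => [K Rc h|n IH K Rc h].
  exists (routput Rc [::]) => x Kx.
  by apply: (h x (fun _ v => dotv x v)) => // s v; rewrite subrr normr0.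
exists (rquery Rc [::]); first exact: rquery_unit.
move=> a; apply: (IH _ (recon_after Rc a)) => x A [Kx ax] vA.
(* A valid adversary must be correct on every vector, so [A'] gives the prescribed answer [a] only
   to the actual first query and is truthful on all other opening vectors. *)
pose A' h v := if h is _ :: h' then A h' v else
  if v == rquery Rc [::] then a else dotv x v.
have vA' : valid_adv delta x A'.
  move=> [|e h'] v /=; last exact: vA.
  by case: eqP => [->|_] //; rewrite subrr normr0.
by have := h x A' Kx vA'; rewrite recon_err_cons /= eqxx.
Qed.

Lemma OPT_le_win delta r T : (0 < d)%N -> win delta r T (fun=> True) ->
  (OPT d T delta <= r%:E)%E.
Proof.
move=> d0 /(recon_of_win d0)[Rc hRc].
apply: (@le_trans _ _ _ _ _ (ereal_inf_lbound _)); first by exists Rc.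
apply: ub_ereal_sup => _ [[x A] /= vA <-].
by rewrite lee_fin; exact: hRc.
Qed.

Lemma win_OPT_lt delta r T : 0 <= delta -> (OPT d T delta < r%:E)%E ->
  win delta r T (fun=> True).
Proof.
move=> delta0 /ereal_inf_lt[_ [Rc _ <-]] h.
apply: (@win_of_recon _ _ _ _ Rc) => // x A _ vA.
rewrite -lee_fin; apply: le_trans (ltW h).
by apply: ereal_sup_ubound; exists (x, A).
Qed.

(** The game is homogeneous, which reduces both bounds to noise level 1. *)
Lemma win_scale delta r c n K K' : 0 < c ->
  (forall x, K' x -> K (c^-1 *: x)) ->
  win delta r n K -> win (c * delta) (c * r) n K'.
Proof.
move=> c0; elim: n K K' => [K K' h [y hy]|n IH K K' h [v v1 hv]].
  exists (c *: y) => x K'x.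
  have -> : c *: y - x = c *: (y - c^-1 *: x).
    by rewrite scalerBr scalerA divff ?scale1r // gt_eqF.
  by rewrite (euclZ _ (ltW c0)) (ler_pM2l c0); apply: hy; exact: h.
exists v => // a; apply: IH (hv (c^-1 * a)) => x [K'x hx].
split; first exact: h.
rewrite dotvZl -mulrBr normrM ger0_norm ?invr_ge0 ?(ltW c0) //.
by rewrite ler_pdivrMl.
Qed.

Lemma win_sub delta r n K K' : (forall x, K' x -> K x) ->
  win delta r n K -> win delta r n K'.
Proof.
elim: n K K' => [K K' h [y hy]|n IH K K' h [v v1 hv]].
  by exists y => x /h; exact: hy.
by exists v => // a; apply: IH (hv a) => x [/h].
Qed.

Lemma win_le delta r r' n K : r <= r' -> win delta r n K -> win delta r' n K.
Proof.
move=> rr; elim: n K => [K [y hy]|n IH K [v v1 hv]].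
  by exists y => x /hy h; exact: le_trans h rr.
by exists v => // a; exact: IH (hv a).
Qed.

Lemma win_more delta r m n K : (0 < d)%N -> (m <= n)%N ->
  win delta r m K -> win delta r n K.
Proof.
move=> d0; elim: n m K => [|n IH] [|m] K //=.
- move=> _ h; have [v v1] := exists_unit d0; exists v => // a.
  by apply: (IH 0%N) => //; apply: (@win_sub _ _ 0 K) => [x []|].
- by move=> mn [v v1 hv]; exists v => // a; exact: (IH m).
Qed.

(** A block of queries fixed in advance. Two secrets consistent with the same answer have
    projections within [2 * delta] of each other, and only this information is kept. *)
Lemma win_queries delta r n (vs : seq 'rV[R]_d) K :
  (forall v, v \in vs -> dotv v v = 1) ->
  (forall K' : _ -> Prop, (forall x, K' x -> K x) ->
     (forall v x y, v \in vs -> K' x -> K' y -> `|dotv (x - y) v| <= 2 * delta) ->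
     win delta r n K') ->
  win delta r (size vs + n) K.
Proof.
elim: vs K => [|v vs IH] K vs1 h /=; first by apply: h.
exists v; first by apply: vs1; rewrite mem_head.
move=> a; apply: IH => [u uvs|K' K'K h'].
  by apply: vs1; rewrite inE uvs orbT.
apply: h => [x /K'K[]//|u x y].
rewrite inE => /predU1P[->|uvs] K'x K'y; last exact: h'.
have [_ ax] := K'K _ K'x; have [_ ay] := K'K _ K'y.
move: ax ay; rewrite dotvDl dotvNl !ler_norml => /andP[? ?] /andP[? ?].
by apply/andP; split; lra.
Qed.

End GameValue.

(** * Lower bound *)

Section PairSums.
Variables (R : realType) (d : nat) (I : finType).
Implicit Types (mu : I -> R) (q : I -> 'rV[R]_d).

Lemma sum_pair_dist mu q :
  \sum_i \sum_j mu i * mu j * dotv (q i - q j) (q i - q j) =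
  2 * (\sum_i mu i) * (\sum_i mu i * dotv (q i) (q i)) -
  2 * dotv (\sum_i mu i *: q i) (\sum_i mu i *: q i).
Proof.
transitivity (\sum_i \sum_j (mu i * (mu j * dotv (q j) (q j)) +
    (mu i * dotv (q i) (q i) * mu j - 2 * (mu i * (mu j * dotv (q i) (q j)))))).
  apply: eq_bigr => i _; apply: eq_bigr => j _.
  by rewrite !dotvE (dotvC (q j) (q i)); ring.
have e1 : dotv (\sum_i mu i *: q i) (\sum_i mu i *: q i) =
    \sum_i \sum_j mu i * (mu j * dotv (q i) (q j)).
  rewrite dotv_suml; apply: eq_bigr => i _.
  rewrite dotvC dotv_suml; apply: eq_bigr => j _.
  by rewrite dotvZl dotvZr (dotvC (q j)); ring.
rewrite e1.
under eq_bigr do rewrite big_split sumrB /= -[X in _ + (_ - X)]mulr_sumr.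
rewrite big_split sumrB /= -[X in _ + (_ - X) = _]mulr_sumr.
rewrite -!big_distrlr /=; ring.
Qed.

End PairSums.

(** * Rotations in a plane *)

Section Rotation.
Variables (R : realType) (d : nat) (v w : 'rV[R]_d) (c s : R).
Hypotheses (v1 : dotv v v = 1) (w1 : dotv w w = 1) (vw : dotv v w = 0).
Hypothesis cs1 : c ^+ 2 + s ^+ 2 = 1.

(* Rotation by the angle of cosine [c] and sine [s] in the plane of the
   orthonormal vectors [v] and [w]. *)
Definition rot x : 'rV[R]_d :=
  x + (((c - 1) * dotv x v - s * dotv x w) *: v
       + (s * dotv x v + (c - 1) * dotv x w) *: w).

Lemma rotB x y : rot (x - y) = rot x - rot y.
Proof. by apply/rowP => i; rewrite !mxE !dotvE; ring. Qed.

Lemma dotv_rot x : dotv (rot x) (rot x) = dotv x x.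
Proof.
rewrite /rot !dotvE v1 w1 vw (dotvC w v) vw (dotvC v x) (dotvC w x).
set a := dotv x v; set b := dotv x w.
transitivity (dotv x x + (a ^+ 2 + b ^+ 2) * (c ^+ 2 + s ^+ 2 - 1)); first ring.
by rewrite cs1 subrr mulr0 addr0.
Qed.

Lemma dotv_rot_axis x : dotv (rot x) v = c * dotv x v - s * dotv x w.
Proof. by rewrite /rot !dotvE v1 (dotvC w v) vw; ring. Qed.

Lemma rot_displacement x : c <= 1 ->
  dotv (rot x - x) (rot x - x) <= 4 * dotv x x * (1 - c).
Proof.
move=> c1; rewrite /rot addrAC subrr add0r !dotvE v1 w1 vw (dotvC w v) vw.
have := dotv_unit_sqr x v1; have := dotv_unit_sqr x w1.
set a := dotv x v; set b := dotv x w => hb ha.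
apply: (@le_trans _ _ ((a ^+ 2 + b ^+ 2) * (2 * (1 - c) + (c ^+ 2 + s ^+ 2 - 1)))).
  by rewrite le_eqVlt; apply/orP; left; apply/eqP; ring.
rewrite cs1 subrr addr0.
have : (dotv x x * 2 - (a ^+ 2 + b ^+ 2)) * (1 - c) >= 0.
  by apply: mulr_ge0; lra.
lra.
Qed.

End Rotation.

(** * The adversary that preserves a regular simplex *)

Section Adversary.
Variables (R : realType) (d : nat).
Hypothesis d2 : (2 <= d)%N.
Implicit Types (p : 'I_d.+1 -> 'rV[R]_d) (v w x : 'rV[R]_d).

Lemma exists_orthogonal v : exists2 w, dotv w w = 1 & dotv v w = 0.
Proof.
pose i0 : 'I_d := Ordinal (ltnW d2); pose i1 : 'I_d := Ordinal d2.
have i01 : (i0 == i1) = false by [].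
pose x := v 0 i1 *: delta_mx 0 i0 - v 0 i0 *: delta_mx 0 i1 : 'rV[R]_d.
have vx : dotv v x = 0 by rewrite !dotvE !dotv_delta; ring.
have [x0|/normalize_unit[w w1 [a a0 xE]]] := eqVneq x 0.
  exists (delta_mx 0 i0); rewrite dotv_delta; first by rewrite mxE !eqxx.
  move/rowP/(_ i1): x0; rewrite !mxE (eq_sym i1) i01 ?eqxx /= mulr0 add0r ?eqxx mulr1.
  by move=> /eqP; rewrite oppr_eq0 => /eqP.
exists w => //; apply/eqP; move/eqP: vx.
by rewrite xE dotvZr mulf_eq0 gt_eqF.
Qed.

(** The simplex will be rotated about the origin, so the displacement of a vertex is controlled by
    its norm. The bound 5 leaves room for [l ^+ 2 / 2], which is at most 9/2 when [l <= 3]. *)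
Definition simplex (l : R) p :=
  (forall i, dotv (p i) (p i) <= 5) /\
  (forall i j, i != j -> dotv (p i - p j) (p i - p j) = l ^+ 2).

(* The unit vectors of the axes and a point on the diagonal. *)
Lemma exists_simplex l : 2 <= l <= 3 -> exists p, simplex l p.
Proof.
move=> /andP[l2 l3].
have d0 : 0 < d%:R :> R by rewrite ltr0n ltnW.
pose r := Num.sqrt (1 + d%:R : R).
have r2 : r ^+ 2 = 1 + d%:R by rewrite sqr_sqrtr // addr_ge0 ?ler0n.
have r1 : 1 <= r by rewrite -sqrtr1 ler_wsqrtr // lerDl ler0n.
(* The negative root of [d * t ^+ 2 = 1 + 2 * t], the equation placing the diagonal point at squared
   distance 2 from each axis vector. As [t <= 0], its squared norm [1 + 2 * t] is at most 1. *)
pose t := (1 - r) / d%:R.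
have tE : d%:R * t ^+ 2 = 1 + 2 * t.
  have -> : d%:R * t ^+ 2 = (1 - r) ^+ 2 / d%:R by rewrite /t; field; rewrite gt_eqF.
  have -> : (1 - r) ^+ 2 = d%:R + 2 * (1 - r) by lra.
  by rewrite /t; field; rewrite gt_eqF.
have t0 : t <= 0 by rewrite pmulr_lle0 ?invr_gt0 //; lra.
pose p0 (i : 'I_d.+1) : 'rV[R]_d :=
  if unlift ord0 i is Some k then delta_mx 0 k else t *: const_mx 1.
have dd (k j : 'I_d) : dotv (delta_mx 0 k) (delta_mx 0 j) = (j == k)%:R :> R.
  by rewrite dotv_delta mxE eqxx.
have dc (k : 'I_d) : dotv (const_mx 1) (delta_mx 0 k) = 1 :> R.
  by rewrite dotv_delta mxE.
have cc : dotv (const_mx 1 : 'rV[R]_d) (const_mx 1) = d%:R :> R.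
  transitivity (\sum_(i < d) (1 : R)); last by rewrite sumr_const card_ord.
  by apply: eq_bigr => i _; rewrite !mxE mulr1.
have p0_le i : dotv (p0 i) (p0 i) <= 1.
  rewrite /p0; case: unlift => [k|]; first by rewrite dd eqxx.
  by rewrite !dotvE cc; lra.
have p0_ne i j : i != j -> dotv (p0 i - p0 j) (p0 i - p0 j) = 2.
  rewrite /p0; case: (unliftP ord0 i) => [k ->|->]; case: (unliftP ord0 j) => [m ->|->] //.
  - move=> km; have {}km : k != m by apply: contra km => /eqP ->.
    by rewrite !dotvE !dd !eqxx (eq_sym m) (negbTE km); rewrite /=; lra.
  - by move=> _; rewrite !dotvE !dd (dotvC (delta_mx _ _) (const_mx _)) !dc cc eqxx /=; lra.
  - by move=> _; rewrite !dotvE !dd (dotvC (delta_mx _ _) (const_mx _)) !dc cc eqxx /=; lra.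
pose a := l / Num.sqrt 2.
have a2 : a ^+ 2 * 2 = l ^+ 2.
  by rewrite /a exprMn exprVn sqr_sqrtr ?ler0n // -mulrA mulVf ?mulr1 ?pnatr_eq0.
exists (fun i => a *: p0 i); split=> [i|i j ij].
  rewrite dotvZl dotvZr mulrA -expr2.
  have : (1 - dotv (p0 i) (p0 i)) * a ^+ 2 >= 0.
    by apply: mulr_ge0; rewrite ?sqr_ge0 // subr_ge0.
  by nra.
by rewrite -scalerBr dotvZl dotvZr p0_ne // mulrA -expr2.
Qed.

(** The midpoint between the extreme projections serves as the common answer. *)
Lemma simplex_answer p v (b : R) :
  (forall i j, dotv (p i - p j) v <= 2 * b) ->
  exists r, forall i, `|r - dotv (p i) v| <= b.
Proof.
move=> h; pose f i := dotv (p i) v.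
pose M := f [arg max_(i > ord0) f i]%O; pose m := f [arg min_(i < ord0) f i]%O.
have Mm : M - m <= 2 * b by rewrite /M /m /f -dotvNl -dotvDl.
exists ((M + m) / 2) => i.
have : f i <= M by rewrite /M; case: arg_maxP => // j _; apply.
have : m <= f i by rewrite /m; case: arg_minP => // j _; apply.
by rewrite /f => ? ?; rewrite ler_norml; apply/andP; split; lra.
Qed.

(* At most one ordered pair of vertices is nearly parallel to the query;
   turning the simplex by an angle of order [eta] shortens its projection
   below 2 while all the other projections stay far below 2. *)
Lemma simplex_step (eta l : R) p v : 0 < eta <= 1 ->
  2 <= l <= 2 + eta ^+ 2 / 512 -> simplex l p -> dotv v v = 1 ->
  exists p' r, [/\ simplex l p',
    forall i, dotv (p' i - p i) (p' i - p i) <= (eta / 2) ^+ 2 &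
    forall i, `|r - dotv (p' i) v| <= 1 - eta ^+ 2 / 512].
Proof.
move=> /andP[eta0 eta1] /andP[l2 lle] [p5 pl] v1.
pose t := eta / 16.
have etaE : eta = 16 * t by rewrite /t; lra.
have t0 : 0 < t by rewrite /t; lra.
have t16 : t <= 1 / 16 by rewrite /t; lra.
have eta2 : eta ^+ 2 / 512 = t ^+ 2 / 2 by rewrite etaE; field.
have tt : t ^+ 2 <= 1 / 256.
  have : (1 / 16 - t) * (1 / 16 + t) >= 0 by apply: mulr_ge0; lra.
  lra.
rewrite eta2 in lle *.
have l3 : l <= 2 + 1 / 512 by lra.
have [bad|good] := pselect (exists i j, dotv (p i - p j) v > 2 - t ^+ 2); last first.
  have [r hr] : exists r, forall i, `|r - dotv (p i) v| <= 1 - t ^+ 2 / 2.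
    apply: simplex_answer => i j; rewrite leNgt; apply/negP => h.
    by apply: good; exists i, j; lra.
  exists p, r; split=> // i; rewrite subrr dotv0l; exact: sqr_ge0.
have [i [j bad_ij]] := bad.
pose X := p i - p j.
have ij : i != j.
  apply/eqP => ij; move: bad_ij; rewrite ij subrr dotv0l; lra.
(* The sign of [w] is chosen so that the rotation turns the bad edge [X] away from [v]. *)
have [w [w1 vw Xw]] : exists w, [/\ dotv w w = 1, dotv v w = 0 & 0 <= dotv X w].
  have [w w1 vw] := exists_orthogonal v.
  have [?|?] := leP 0 (dotv X w); first by exists w.
  by exists (- w); rewrite dotvNl !dotvNr opprK vw oppr0; split=> //; lra.
pose D := 1 + t ^+ 2.
have D1 : 1 <= D by rewrite /D; have := sqr_ge0 t; lra.
(* Rational parametrisation of the circle: [t] is the tangent of half the rotation angle. *)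
pose c := (1 - t ^+ 2) / D; pose s := 2 * t / D.
have D0 : D != 0 by rewrite gt_eqF //; lra.
have cs1 : c ^+ 2 + s ^+ 2 = 1 by rewrite /c /s /D; field; exact: D0.
have cD : c * D = 1 - t ^+ 2 by rewrite /c mulfVK.
have sD : s * D = 2 * t by rewrite /s mulfVK.
have t2 := sqr_ge0 t.
have c0 : 0 <= c by apply: divr_ge0; lra.
have c1 : c <= 1 by rewrite ler_pdivrMr /D; lra.
have s0 : 0 <= s by apply: divr_ge0; lra.
have s8 : s <= 2 * t by rewrite -sD ler_peMr.
have onec : 1 - c <= 2 * t ^+ 2.
  have : (1 - c) * D = 2 * t ^+ 2 by rewrite mulrBl cD mul1r /D; lra.
  by move=> <-; rewrite ler_peMr // subr_ge0.
have bound k m : dotv (p k - p m) (p k - p m) <= l ^+ 2.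
  have [->|km] := eqVneq k m; first by rewrite subrr dotv0l sqr_ge0.
  by rewrite pl.
have proj k m u : dotv u u = 1 -> `|dotv (p k - p m) u| <= l.
  move=> u1; have := dotv_unit_sqr (p k - p m) u1 => h.
  rewrite -ler_sqr ?nnegrE ?normr_ge0 //; last lra.
  by rewrite real_normK ?num_real //; exact: le_trans h (bound _ _).
have width k m : dotv (rot v w c s (p k) - rot v w c s (p m)) v <= 2 * (1 - t ^+ 2 / 2).
  rewrite -rotB dotv_rot_axis //.
  have [<-|km] := eqVneq k m; first by rewrite subrr !dotv0l; lra.
  have [/andP[/eqP -> /eqP ->]|ne] := boolP ((k == i) && (m == j)).
    have : dotv X v <= l by apply: le_trans (ler_norm _) (proj _ _ _ v1).
    rewrite -/X => Xv.
    have h1 : c * dotv X v <= c * l by exact: ler_wpM2l.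
    have h2 : 0 <= s * dotv X w by exact: mulr_ge0.
    have h3 : c * l <= 2 - t ^+ 2.
      rewrite /c mulrAC ler_pdivrMr; last lra.
      have : (2 + t ^+ 2 / 2 - l) * (1 - t ^+ 2) >= 0 by apply: mulr_ge0; lra.
      have : t ^+ 2 * (1 / 256 - t ^+ 2) >= 0 by apply: mulr_ge0; lra.
      rewrite /D; lra.
    lra.
  pose Y := p k - p m; rewrite -/Y.
  (* Any other ordered pair makes an angle of at least 60 degrees with [X], unless it is degenerate.
     Then [X + Y] has squared length at most [3 * l ^+ 2], and since [X] nearly exhausts its
     projection on [v], at most 3/2 is left for [Y]. *)
  have XY : 2 * dotv X Y <= l ^+ 2.
    have -> : 2 * dotv X Y =
        dotv (p i - p m) (p i - p m) + dotv (p j - p k) (p j - p k)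
        - dotv (p k - p i) (p k - p i) - dotv (p m - p j) (p m - p j).
      rewrite /X /Y !dotvE (dotvC (p m) (p i)) (dotvC (p k) (p j)) (dotvC (p m) (p j)).
      by rewrite (dotvC (p k) (p i)); ring.
    have := bound i m; have := bound j k.
    have := dotv_ge0 (p k - p i); have := dotv_ge0 (p m - p j).
    move: ne; rewrite negb_and => /orP[/pl ->|/pl ->]; lra.
  have XYv : (dotv X v + dotv Y v) ^+ 2 <= 3 * l ^+ 2.
    rewrite -dotvDl; apply: le_trans (dotv_unit_sqr _ v1) _.
    rewrite dotvDl 2!dotvDr (dotvC Y X).
    have := bound i j; have := bound k m; rewrite -/X -/Y; lra.
  have Yv : dotv Y v <= 3 / 2.
    rewrite leNgt; apply/negP => Yv.
    have : (dotv X v + dotv Y v - (7 / 2 - 1 / 256)) * (dotv X v + dotv Y v + 1) >= 0.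
      by apply: mulr_ge0; rewrite -/X in bad_ij *; lra.
    have : (2 + 1 / 512 - l) * (l + 1) >= 0 by apply: mulr_ge0; lra.
    rewrite -/X in bad_ij *; lra.
  have Yw : - s * dotv Y w <= 1 / 8 * 3.
    have := proj k m w w1; rewrite -/Y ler_norml => /andP[Yw _].
    have : s * (l + dotv Y w) >= 0 by apply: mulr_ge0; lra.
    have : (1 / 8 - s) * l >= 0 by apply: mulr_ge0; lra.
    lra.
  have cY : c * dotv Y v <= 3 / 2.
    have : c * (3 / 2 - dotv Y v) >= 0 by apply: mulr_ge0; lra.
    lra.
  lra.
have [r hr] := simplex_answer width.
exists (fun i => rot v w c s (p i)), r; split=> //.
  by split=> [k|k m km]; rewrite -?rotB dotv_rot //; exact: pl.
(* The squared displacement is at most [4 * 5 * (2 * t ^+ 2)], below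
   [(eta / 2) ^+ 2 = 64 * t ^+ 2]. *)
move=> k; apply: le_trans (rot_displacement _ _ _ _ _ _) _ => //.
have : dotv (p k) (p k) * (2 * t ^+ 2 - (1 - c)) >= 0.
  by apply: mulr_ge0; [exact: dotv_ge0 | lra].
have : (5 - dotv (p k) (p k)) * t ^+ 2 >= 0.
  by apply: mulr_ge0 => //; rewrite subr_ge0.
rewrite etaE; lra.
Qed.

Lemma iter_scale_bounds n (eta : R) : 0 < eta <= 1 ->
  0 < iter n (fun e => e ^+ 2 / 512) eta <= eta.
Proof.
move=> /andP[e0 e1]; elim: n => [|n /andP[h0 h1]]; first by rewrite e0 /=.
rewrite iterS; set e := iter n _ _ in h0 h1 *.
rewrite divr_gt0 ?exprn_gt0 ?ltr0n //=.
have : e * (1 - e) >= 0 by apply: mulr_ge0; lra.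
lra.
Qed.

(** Induction on the rounds with the edge length [l] fixed and the ball radius shrinking by
    [eta ^+ 2 / 512]. At the end, the mean squared distance from any output to the vertices is at
    least the variance of the regular simplex. *)
Lemma win_lower_bound n K (eta l r : R) p : 0 < eta <= 1 -> 2 <= l ->
  l <= 2 + iter n (fun e => e ^+ 2 / 512) eta -> simplex l p ->
  (forall i x, dotv (x - p i) (x - p i) <= eta ^+ 2 -> K x) ->
  win 1 r n K -> 0 <= r /\ 2 * d%:R / d.+1%:R * (l / 2) ^+ 2 <= r ^+ 2.
Proof.
elim: n K eta p => [|n IH] K eta p eta01 l2 ln pl pK.
  move=> [c hc].
  have Kp i : eucl (c - p i) <= r.
    by apply: hc; apply: (pK i); rewrite subrr dotv0l sqr_ge0.
  have r0 : 0 <= r by apply: le_trans (Kp ord0); exact: sqrtr_ge0.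
  split=> //.
  have := sum_pair_dist (fun=> 1) (fun i => c - p i).
  rewrite sumr_const card_ord.
  set Z := dotv (\sum_i _) _; have Z0 : 0 <= Z by exact: dotv_ge0.
  have h1 : \sum_i 1 * dotv (c - p i) (c - p i) <= d.+1%:R * r ^+ 2.
    rewrite mulrC mulr_natr -[X in _ *+ X](card_ord d.+1) -sumr_const.
    by apply: ler_sum => i _; rewrite mul1r -eucl_le.
  have -> : \sum_(i < d.+1) \sum_(j < d.+1)
      1 * 1 * dotv (c - p i - (c - p j)) (c - p i - (c - p j)) = d.+1%:R * (d%:R * l ^+ 2).
    rewrite [in RHS]mulrC mulr_natr -[X in _ *+ X](card_ord d.+1) -sumr_const.
    apply: eq_bigr => i _; rewrite (bigD1 i) //= subrr dotv0l mulr0 add0r.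
    rewrite (eq_bigr (fun=> l ^+ 2)) => [|j ji].
      by rewrite sumr_const cardC1 card_ord mulr_natl.
    have -> : c - p i - (c - p j) = p j - p i by rewrite opprB addrC addrA subrK.
    by rewrite !mul1r pl.2.
  move=> e.
  have n0 : 0 < d.+1%:R :> R by rewrite ltr0n.
  rewrite mulrAC ler_pdivrMr // -(ler_pM2l n0).
  have : d.+1%:R * (d.+1%:R * r ^+ 2 - \sum_i 1 * dotv (c - p i) (c - p i)) >= 0.
    by apply: mulr_ge0; [exact: ltW | rewrite subr_ge0].
  lra.
move=> [v v1 hv].
have /andP[eta0 eta1] := eta01.
pose eta' := eta ^+ 2 / 512.
have := @iter_scale_bounds 1 _ eta01; rewrite /= -/eta' => /andP[eta'0 eta'le].
have eta'1 : 0 < eta' <= 1 by rewrite eta'0; lra.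
rewrite iterSr -/eta' in ln.
have /andP[_ le_n] := @iter_scale_bounds n _ eta'1.
have [p' [a [p'l p'p ha]]] : exists p' r, [/\ simplex l p',
    forall i, dotv (p' i - p i) (p' i - p i) <= (eta / 2) ^+ 2 &
    forall i, `|r - dotv (p' i) v| <= 1 - eta'].
  apply: simplex_step => //; rewrite -/eta'; apply/andP; split; lra.
apply: (IH _ _ p' eta'1 l2 ln p'l _ (hv a)) => i x xp'; split.
  apply: (pK i).
  have := dotv_sqrD_le (x - p' i) (p' i - p i); rewrite addrA subrK.
  have := p'p i.
  have : (eta / 512 * eta) ^+ 2 <= (eta / 512 ) ^+ 2.
    rewrite exprMn ler_piMr ?sqr_ge0 // expr_le1 //; lra.
  rewrite -/eta' in xp' *.
  have -> : eta / 512 * eta = eta' by rewrite /eta'; ring.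
  have := sqr_ge0 eta; lra.
(* The answer leaves a margin [eta'] at each vertex, which absorbs the move from [p' i] to any point
   of its new ball. *)
have xv : `|dotv (x - p' i) v| <= eta'.
  rewrite -ler_sqr ?nnegrE ?normr_ge0 //; last lra.
  rewrite real_normK ?num_real //; exact: le_trans (dotv_unit_sqr _ v1) xp'.
have -> : a - dotv x v = (a - dotv (p' i) v) - dotv (x - p' i) v.
  by rewrite !dotvE; ring.
by apply: le_trans (ler_normB _ _) _; have := ha i; lra.
Qed.

End Adversary.

(** * Upper bound *)

Section Variance.
Variables (R : realType) (d : nat).

Definition weights (I : finType) (mu : I -> R) :=
  (forall i, 0 <= mu i) /\ \sum_i mu i = 1.

Definition wvariance (I : finType) (mu : I -> R) (q : I -> 'rV[R]_d) :=
  \sum_i mu i * dotv (q i) (q i) -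
  dotv (\sum_i mu i *: q i) (\sum_i mu i *: q i).

Lemma variance_pairs (I : finType) (mu : I -> R) (q : I -> 'rV[R]_d) :
  weights mu ->
  2 * wvariance mu q =
  \sum_i \sum_j mu i * mu j * dotv (q i - q j) (q i - q j).
Proof. by move=> [_ mu1]; rewrite sum_pair_dist mu1 /wvariance; ring. Qed.

(** The rows [(1, q i)] are [d.+2] vectors in dimension [d.+1], hence linearly dependent; the
    leading 1 makes the coefficients sum to 0. *)
Lemma affine_dependence (q : 'I_d.+2 -> 'rV[R]_d) :
  exists b : 'I_d.+2 -> R,
    [/\ exists i, b i != 0, \sum_i b i = 0 & \sum_i b i *: q i = 0].
Proof.
pose M := \matrix_(i < d.+2, j < d.+1)
  (if unlift ord0 j is Some k then q i 0 k else 1).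
have : kermx M != 0.
  by rewrite -mxrank_eq0 mxrank_ker subn_eq0 -ltnNge ltnS rank_leq_col.
case/rowV0Pn => a /sub_kermxP aM a0.
have aMj j : \sum_i a 0 i * M i j = 0.
  by move/rowP/(_ j): aM; rewrite !mxE.
exists (fun i => a 0 i); split.
- case/rV0Pn: a0 => i ai; by exists i.
- have := aMj ord0; under eq_bigr do rewrite mxE unlift_none mulr1.
  by [].
- apply/rowP => k; rewrite summxE mxE.
  have := aMj (lift ord0 k); under eq_bigr do rewrite mxE liftK.
  by move=> e; rewrite -[RHS]e; apply: eq_bigr => i _; rewrite mxE.
Qed.

(* Moving the weights along an affine dependence keeps the mean and changes
   the second moment linearly, so some weight can be brought to 0 without
   decreasing the variance. *)
Lemma variance_caratheodory (mu : 'I_d.+2 -> R) (q : 'I_d.+2 -> 'rV[R]_d) :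
  weights mu -> exists (nu : 'I_d.+1 -> R) (i0 : 'I_d.+2),
    weights nu /\ wvariance mu q <= wvariance nu (fun k => q (lift i0 k)).
Proof.
move=> [mu0 mu1].
have [b [[j bj] b1 bq bs]] : exists b : 'I_d.+2 -> R,
    [/\ exists i, b i != 0, \sum_i b i = 0, \sum_i b i *: q i = 0
      & 0 <= \sum_i b i * dotv (q i) (q i)].
  have [b [[j bj] b1 bq]] := affine_dependence q.
  have [?|bs] := leP 0 (\sum_i b i * dotv (q i) (q i)).
    by exists b; split=> //; exists j.
  exists (fun i => - b i); split.
  - by exists j; rewrite oppr_eq0.
  - by rewrite sumrN b1 oppr0.
  - by under eq_bigr do rewrite scaleNr; rewrite sumrN bq oppr0.
  - by under eq_bigr do rewrite mulNr; rewrite sumrN oppr_ge0 ltW.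
have [i1 bi1] : exists i, b i < 0.
  apply: contrapT => nb; have b0 i : 0 <= b i.
    by rewrite leNgt; apply/negP => bi; apply: nb; exists i.
  move/eqP: b1; rewrite psumr_eq0 // => /allP /(_ j (mem_index_enum _)).
  by rewrite (negbTE bj).
pose f i := mu i / - b i.
(* The first weight to reach 0 when moving along [b]. *)
pose i0 := [arg min_(i < i1 | b i < 0) f i]%O.
have [bi0 min0] : b i0 < 0 /\ forall i, b i < 0 -> f i0 <= f i.
  by rewrite /i0; case: arg_minP.
pose s := f i0; have s0 : 0 <= s by rewrite divr_ge0 ?mu0 // oppr_ge0 ltW.
pose nu i := mu i + s * b i.
have nu0 i : 0 <= nu i.
  have [bi|bi] := leP 0 (b i); first by apply: addr_ge0 => //; exact: mulr_ge0.
  have := min0 i bi; rewrite -/s /f ler_pdivlMr ?oppr_gt0 // /nu; lra.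
have nui0 : nu i0 = 0.
  by rewrite /nu /s /f invrN mulrN mulNr divfK ?subrr // lt_eqF.
have lift_sum (V : nmodType) (F : 'I_d.+2 -> V) :
    F i0 = 0 -> \sum_i F i = \sum_k F (lift i0 k).
  by move=> F0; rewrite (bigD1_ord i0) //= F0 add0r.
exists (fun k => nu (lift i0 k)), i0; split.
  split=> [k|]; first exact: nu0.
  by rewrite -(lift_sum _ nu nui0) big_split /= -mulr_sumr b1 mulr0 addr0.
rewrite /wvariance -(lift_sum _ (fun i => nu i * dotv (q i) (q i))); last first.
  by rewrite nui0 mul0r.
rewrite -(lift_sum _ (fun i => nu i *: q i)); last by rewrite nui0 scale0r.
have -> : \sum_i nu i *: q i = \sum_i mu i *: q i.
  under eq_bigr do rewrite /nu scalerDl -scalerA.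
  by rewrite big_split /= -scaler_sumr bq scaler0 addr0.
rewrite lerD2r.
under [leRHS]eq_bigr do rewrite /nu mulrDl -mulrA.
by rewrite big_split /= -mulr_sumr lerDl mulr_ge0.
Qed.

(* The mean of a weighted simplex of nearly maximal variance is the centre:
   adding a point of [K] far from it with a small weight would increase the
   variance. *)
Lemma variance_center (K : 'rV[R]_d -> Prop) (v tau : R) :
  (forall (mu : 'I_d.+1 -> R) q, weights mu -> (forall i, K (q i)) ->
     wvariance mu q <= v) ->
  0 < tau -> exists c, forall x, K x -> dotv (c - x) (c - x) <= v + tau.
Proof.
move=> hv tau0.
have [[x0 Kx0]|K0] := pselect (exists x, K x); last first.
  by exists 0 => x Kx; case: K0; exists x.
pose E := [set s | exists (mu : 'I_d.+1 -> R) q,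
  [/\ weights mu, forall i, K (q i) & s = wvariance mu q]]%classic.
pose mu0 (i : 'I_d.+1) : R := (i == ord0)%:R.
have mu0w : weights mu0.
  split=> [i|]; first exact: ler0n.
  by rewrite (bigD1 ord0) //= big1 => [|i /negbTE i0]; rewrite /mu0 ?i0 ?eqxx ?addr0.
have E0 : E 0.
  exists mu0, (fun=> x0); split=> //.
  by rewrite /wvariance -mulr_suml -scaler_suml mu0w.2 mul1r scale1r subrr.
have Eub : ubound E v by move=> _ [mu [q [? ? ->]]]; exact: hv.
have supE : has_sup E by split; [exists 0 | exists v].
have v0 : 0 <= v by exact: Eub.
(* The weight given to the new point [x], chosen so that [(1 - t) * (v + tau) = v + tau / 2]. *)
pose t := tau / (2 * (v + tau)).
have tE : t * (v + tau) = tau / 2 by rewrite /t; field; rewrite gt_eqF //; lra.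
have t0 : 0 < t by rewrite divr_gt0 //; lra.
have t1 : t <= 1 / 2.
  rewrite ler_pdivrMr; lra.
have [_ [mu [q [[mup mu1] Kq ->]]]] := sup_adherent (mulr_gt0 t0 (divr_gt0 tau0 (ltr0n _ 2))) supE.
rewrite ltrBlDr => var_sup.
pose c := \sum_i mu i *: q i; exists c => x Kx.
pose q' (i : 'I_d.+2) := if unlift ord0 i is Some k then q k else x.
pose mu' (i : 'I_d.+2) := if unlift ord0 i is Some k then (1 - t) * mu k else t.
have mu'w : weights mu'.
  split=> [i|].
    rewrite /mu'; case: unlift => [k|]; last exact: ltW.
    by apply: mulr_ge0 => //; lra.
  rewrite big_ord_recl /mu' unlift_none; under eq_bigr do rewrite liftK.
  by rewrite -mulr_sumr mu1; lra.
have var' : wvariance mu' q' =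
    (1 - t) * wvariance mu q + t * (1 - t) * dotv (c - x) (c - x).
  have recl (V : nmodType) (F : 'I_d.+2 -> V) :
    \sum_i F i = F ord0 + \sum_k F (lift ord0 k) by rewrite big_ord_recl.
  rewrite /wvariance !recl /mu' /q' !unlift_none.
  under eq_bigr do rewrite !liftK -mulrA.
  under [X in _ - dotv (_ + X) _]eq_bigr do rewrite !liftK -scalerA.
  under [X in _ - dotv _ (_ + X)]eq_bigr do rewrite !liftK -scalerA.
  rewrite -mulr_sumr -!scaler_sumr -/c !dotvE (dotvC x c); ring.
have [nu [i0 [nuw]]] := variance_caratheodory q' mu'w.
rewrite var' => var_le.
have : wvariance nu (fun k => q' (lift i0 k)) <= sup E.
  apply: (sup_upper_bound supE); exists nu, (fun k => q' (lift i0 k)); split=> // k.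
  by rewrite /q'; case: unlift.
have vv : wvariance mu q <= v by exact: hv.
move=> h.
have h1 : t * ((1 - t) * dotv (c - x) (c - x)) <= t * (v + tau / 2) by nra.
rewrite (ler_pM2l t0) in h1.
have t11 : 0 < 1 - t by lra.
rewrite -(ler_pM2l t11); lra.
Qed.

End Variance.

(** * Jung's bound and its stability *)

Section NearlyRegular.
Variables (R : realType) (d : nat).
Hypothesis d0 : (0 < d)%N.
Implicit Types (p q : 'I_d.+1 -> 'rV[R]_d) (mu : 'I_d.+1 -> R).

(* Jung's constant: a set of diameter [2] lies in a ball of squared radius
   [jung2]. *)
Definition jung2 : R := 2 * d%:R / d.+1%:R.

Let N : R := d.+1%:R.
Let N2 : 2 <= N. Proof. by rewrite ler_nat. Qed.
Let N0 : 0 < N. Proof. by rewrite ltr0n. Qed.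
Let Nn : N != 0. Proof. by rewrite pnatr_eq0. Qed.
Let NE : N = d%:R + 1. Proof. by rewrite /N -addn1 natrD. Qed.
Let jung2E : jung2 * N = 2 * (N - 1).
Proof.
by rewrite /jung2 -/N divfK // NE; lra.
Qed.

Lemma sum_sqr_weights mu : weights mu ->
  \sum_i mu i ^+ 2 = N^-1 + \sum_i (mu i - N^-1) ^+ 2.
Proof.
move=> [_ mu1].
have -> : \sum_i (mu i - N^-1) ^+ 2 =
    \sum_i (mu i ^+ 2 - 2 * N^-1 * mu i + N^-1 ^+ 2).
  by apply: eq_bigr => i _; ring.
rewrite big_split sumrB /= -mulr_sumr mu1 sumr_const card_ord -mulr_natl -/N.
by field.
Qed.

Lemma sum_off_diag mu (D : R) : weights mu ->
  \sum_i \sum_j mu i * mu j * (if i == j then 0 else D) =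
  D * (1 - \sum_i mu i ^+ 2).
Proof.
move=> [_ mu1].
have -> : D * (1 - \sum_i mu i ^+ 2) = \sum_i (D * mu i - D * mu i ^+ 2).
  by rewrite sumrB -!mulr_sumr mu1; ring.
apply: eq_bigr => i _.
transitivity (\sum_j (D * mu i * mu j - (if j == i then D * mu i ^+ 2 else 0))).
  by apply: eq_bigr => j _; rewrite eq_sym; case: eqP => [->|_]; ring.
by rewrite sumrB -mulr_sumr mu1 mulr1 -big_mkcond big_pred1_eq.
Qed.

(** Jung's theorem in variance form: twice the variance is a weighted sum of squared distances whose
    off-diagonal weight [1 - \sum_i mu i ^+ 2] is largest for equal weights. *)
Lemma variance_le_diam mu q (D : R) : weights mu -> 0 <= D ->
  (forall i j, i != j -> dotv (q i - q j) (q i - q j) <= D) ->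
  wvariance mu q <= jung2 * D / 4.
Proof.
move=> muw D0 qD.
have : 2 * wvariance mu q <= D * (1 - \sum_i mu i ^+ 2).
  rewrite variance_pairs // -sum_off_diag //.
  apply: ler_sum => i _; apply: ler_sum => j _.
  apply: ler_wpM2l; first by apply: mulr_ge0; exact: muw.1.
  by case: eqP => [->|/eqP/qD//]; rewrite subrr dotv0l.
rewrite sum_sqr_weights //.
have S0 : 0 <= \sum_i (mu i - N^-1) ^+ 2 by apply: sumr_ge0 => i _; exact: sqr_ge0.
have DS := mulr_ge0 D0 S0.
have -> : jung2 = 2 * (1 - N^-1).
  by apply: (mulIf Nn); rewrite jung2E; field.
move: DS; set S := \sum_i _; set M := N^-1; lra.
Qed.

(** Stability in Jung's theorem. The weighted deficits [G] are nonnegative with sum at most [e], and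
    the weights are close to uniform, so no single distance can have a large deficit. *)
Lemma nearly_regular mu q (e : R) : weights mu -> jung2 < wvariance mu q ->
  0 <= e -> N ^+ 2 * e <= 1 ->
  (forall i j, i != j -> dotv (q i - q j) (q i - q j) <= 4 + e) ->
  forall i j, i != j -> 4 - 4 * N ^+ 2 * e <= dotv (q i - q j) (q i - q j).
Proof.
move=> muw var e0 e1 qe i j ij.
pose G i j := mu i * mu j * ((if i == j then 0 else 4 + e) - dotv (q i - q j) (q i - q j)).
have G0 a b : 0 <= G a b.
  apply: mulr_ge0; first by apply: mulr_ge0; exact: muw.1.
  by rewrite subr_ge0; case: eqP => [->|/eqP/qe//]; rewrite subrr dotv0l.
have sumG : \sum_a \sum_b G a b = (4 + e) * (1 - \sum_i mu i ^+ 2) - 2 * wvariance mu q.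
  rewrite variance_pairs // -sum_off_diag // -sumrB; apply: eq_bigr => a _.
  by rewrite -sumrB; apply: eq_bigr => b _; rewrite /G mulrBr.
have jE : jung2 = 2 * (1 - N^-1) by apply: (mulIf Nn); rewrite jung2E; field.
set S := \sum_i (mu i - N^-1) ^+ 2 in sumG.
rewrite sum_sqr_weights // -/S in sumG.
have S0 : 0 <= S by apply: sumr_ge0 => k _; exact: sqr_ge0.
have Ni0 : 0 < N^-1 by rewrite invr_gt0.
have Gsum0 : 0 <= \sum_a \sum_b G a b by apply: sumr_ge0 => a _; apply: sumr_ge0.
have e_le : e <= N^-1 * N^-1.
  have -> : N^-1 * N^-1 = N^-1 ^+ 2 * 1 by rewrite mulr1.
  have -> : e = N^-1 ^+ 2 * (N ^+ 2 * e) by field.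
  by apply: ler_wpM2l => //; exact: sqr_ge0.
have N2M x : x = N ^+ 2 * (N^-1 * N^-1 * x) by field.
rewrite jE in var; set M := N^-1 in var sumG Ni0 e_le N2M.
have eNi : 0 <= e * M by apply: mulr_ge0 => //; exact: ltW.
have eS : 0 <= e * S by exact: mulr_ge0.
have S_le : 4 * S <= e by lra.
(* Since [4 * S <= e <= M ^+ 2], each weight is within [M / 2] of [M]. *)
have mu_ge k : M / 2 <= mu k.
  have : (mu k - M) ^+ 2 <= S.
    by rewrite /S (bigD1 k) //= lerDl sumr_ge0 // => a _; exact: sqr_ge0.
  move=> h; rewrite leNgt; apply/negP => lt.
  have : (M / 2) * (M / 2) < (M - mu k) * (M - mu k).
    apply: ltr_pM; lra.
  lra.
have Gij : G i j <= e.
  have : G i j <= \sum_a \sum_b G a b.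
    rewrite (bigD1 i) //= (bigD1 j) //= -addrA lerDl addr_ge0 ?sumr_ge0 // => a _.
    exact: sumr_ge0.
  lra.
have := qe i j ij; rewrite /G (negbTE ij) in Gij *.
set D := dotv _ _ in Gij * => De.
have : mu i * mu j * (4 + e - D) >= (M / 2) * (M / 2) * (4 + e - D).
  apply: ler_wpM2r; first lra.
  by apply: ler_pM => //; lra.
move=> h.
have h2 : M * M * (4 + e - D) <= 4 * e by lra.
have : (4 + e - D) <= N ^+ 2 * (4 * e).
  rewrite {1}(N2M (4 + e - D)).
  by apply: ler_wpM2l => //; exact: sqr_ge0.
lra.
Qed.

(* If [B] has rows [b i], then [B B^T] is above the identity, hence so is
   [B^T B]. *)
Lemma dotv_bound_of_gram (b : 'I_d -> 'rV[R]_d) (k m : R) e :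
  d%:R * k <= 1 ->
  (forall i j, `|dotv (b i) (b j) - (2 + 2 * (i == j)%:R)| <= k) ->
  (forall i, `|dotv e (b i)| <= m) -> dotv e e <= d%:R * m ^+ 2.
Proof.
move=> dk hb he.
pose B := \matrix_i b i.
have mulB (a : 'rV_d) : a *m B = \sum_i a 0 i *: b i.
  by rewrite mulmx_sum_row; apply: eq_bigr => i _; rewrite rowK.
have gram (a : 'rV_d) : \sum_i a 0 i ^+ 2 <= dotv (a *m B) (a *m B).
  have -> : dotv (a *m B) (a *m B) =
      \sum_i \sum_j a 0 i * a 0 j * dotv (b i) (b j).
    rewrite mulB dotv_suml; apply: eq_bigr => i _.
    rewrite dotvC dotv_suml; apply: eq_bigr => j _.
    by rewrite dotvZl dotvZr (dotvC (b j)); ring.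
  (* The Gram matrix is twice the identity plus twice the all-ones matrix, up to entries of size
     [k]; the error costs at most [d * k <= 1] times the squared norm of [a]. *)
  apply: (@le_trans _ _ (\sum_i \sum_j (2 * (a 0 i * a 0 j)
      + (if j == i then 2 * a 0 i ^+ 2 else 0)
      - (k / 2 * a 0 i ^+ 2 + k / 2 * a 0 j ^+ 2)))).
    under [leRHS]eq_bigr do
      rewrite sumrB big_split /= -mulr_sumr -big_mkcond big_pred1_eq big_split /=
        sumr_const card_ord -mulr_sumr -mulr_sumr.
    rewrite sumrB !big_split /= sumrMnl sumr_const card_ord -!mulr_sumr -mulr_suml.
    pose D : R := d%:R.
    have natE x : x *+ d = D * x by rewrite mulr_natl.
    rewrite !natE; rewrite -/D in dk.
    set S := \sum_i a 0 i ^+ 2; set T := \sum_i a 0 i.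
    have S0 : 0 <= S by apply: sumr_ge0 => i _; exact: sqr_ge0.
    have := sqr_ge0 T; have : S * (1 - D * k) >= 0 by apply: mulr_ge0; lra.
    lra.
  apply: ler_sum => i _; apply: ler_sum => j _.
  have := hb i j; rewrite (eq_sym j i).
  set g := dotv _ _; rewrite ler_norml => /andP[g1 g2].
  have k0 : 0 <= k by lra.
  have h1 : 0 <= (g - (2 + 2 * (i == j)%:R) + k) * (a 0 i + a 0 j) ^+ 2.
    by apply: mulr_ge0; [lra | exact: sqr_ge0].
  have h2 : 0 <= (k - (g - (2 + 2 * (i == j)%:R))) * (a 0 i - a 0 j) ^+ 2.
    by apply: mulr_ge0; [lra | exact: sqr_ge0].
  case: eqP h1 h2 => [->|_] /= h1 h2; lra.
have Bu : B \in unitmx.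
  rewrite -row_free_unit; apply: inj_row_free => a aB.
  have := gram a; rewrite aB dotv0l => h.
  apply: dotv_eq0; apply/eqP; rewrite eq_le dotv_ge0 andbT.
  by apply: le_trans h; apply: ler_sum => i _; rewrite expr2.
pose a := e *m invmx B.
have eE : e = a *m B by rewrite mulmxKV.
have := gram a; rewrite -eE.
(* Here [dotv e e = \sum_i a 0 i * dotv e (b i)]; after Young's inequality, the terms in [a] are
   absorbed by half of [dotv e e]. *)
have : dotv e e <= \sum_i (a 0 i ^+ 2 / 2 + m ^+ 2 / 2).
  rewrite {1}eE mulB dotv_suml; apply: ler_sum => i _.
  rewrite dotvZl dotvC; have := he i; set g := dotv _ _ => gm.
  have : g ^+ 2 <= m ^+ 2.
    by rewrite -(real_normK (num_real g)) ler_sqr ?nnegrE ?normr_ge0 // (le_trans _ gm).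
  have := sqr_ge0 (a 0 i - g); lra.
rewrite big_split /= -mulr_suml sumr_const card_ord -mulr_natl; lra.
Qed.

(** The displacement of vertex [i] has a scalar product of order [e] with every edge of [p] at [i]:
    from above by the cross distances, from below because the edges of [q] are not short. These
    edges are well conditioned, so a squared displacement known to be at most [e] is in fact of
    order [e ^+ 2]. *)
Lemma nearly_regular_close p q (e : R) : 0 <= e -> 8 * N ^+ 3 * e <= 1 ->
  (forall i j, i != j -> dotv (p i - p j) (p i - p j) <= 4 + e) ->
  (forall i j, i != j -> dotv (q i - p j) (q i - p j) <= 4 + e) ->
  (forall i j, i != j -> 4 - 4 * N ^+ 2 * e <= dotv (p i - p j) (p i - p j)) ->
  (forall i j, i != j -> 4 - 4 * N ^+ 2 * e <= dotv (q i - q j) (q i - q j)) ->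
  (forall i, dotv (q i - p i) (q i - p i) <= e) ->
  forall i, dotv (q i - p i) (q i - p i) <= (8 * N ^+ 3 * e) ^+ 2.
Proof.
move=> e0 e1 pp qp ppl qql near i.
have N_ge2 : 2 <= N by exact: N2.
have N2e : 4 * e <= N ^+ 2 * e.
  apply: ler_wpM2r => //.
  have : (N - 2) * (N + 2) >= 0 by apply: mulr_ge0; lra.
  lra.
have up a j : a != j -> 2 * dotv (q a - p a) (p a - p j) <= (1 + 4 * N ^+ 2) * e.
  move=> aj; have := qp a j aj; have := ppl a j aj; have := dotv_ge0 (q a - p a).
  have -> : dotv (q a - p j) (q a - p j) = dotv (q a - p a) (q a - p a)
      + 2 * dotv (q a - p a) (p a - p j) + dotv (p a - p j) (p a - p j).
    have -> : q a - p j = (q a - p a) + (p a - p j) by rewrite addrA subrK.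
    by rewrite dotv_sqrD.
  lra.
have lo j : i != j -> - (6 + 8 * N ^+ 2) * e <= 2 * dotv (q i - p i) (p i - p j).
  move=> ij; have := qql i j ij; have := pp i j ij.
  have := up j i; rewrite eq_sym => /(_ ij).
  have := dotv_sqrB_le (q i - p i) (q j - p j).
  have := near i; have := near j.
  have -> : dotv (q i - q j) (q i - q j) =
      dotv (q i - p i - (q j - p j)) (q i - p i - (q j - p j))
      + 2 * dotv (q i - p i) (p i - p j) + 2 * dotv (q j - p j) (p j - p i)
      + dotv (p i - p j) (p i - p j).
    have -> : q i - q j = (q i - p i - (q j - p j)) + (p i - p j).
      by apply/rowP => k; rewrite !mxE; ring.
    rewrite dotv_sqrD.
    have -> : dotv (q j - p j) (p j - p i) = - dotv (q j - p j) (p i - p j).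
      by rewrite -dotvNr opprB.
    by rewrite [dotv (_ - _ - _) (p i - p j)]dotvDl [dotv (- (q j - p j)) _]dotvNl; ring.
  lra.
have DD a b : a != b -> `|dotv (p a - p b) (p a - p b) - 4| <= 4 * N ^+ 2 * e.
  move=> ab; rewrite ler_norml; have := pp a b ab; have := ppl a b ab => ? ?.
  by apply/andP; split; lra.
pose b (j : 'I_d) := p (lift i j) - p i.
have := @dotv_bound_of_gram b (8 * N ^+ 2 * e) (8 * N ^+ 2 * e) (q i - p i).
have dN : d%:R = N - 1 by rewrite NE addrK.
have N2e0 : 0 <= N ^+ 2 * e by apply: mulr_ge0 => //; exact: sqr_ge0.
rewrite dN; case/(_ _ _ _)/wrap.
- lra.
- move=> j k; rewrite /b.
  have jE := DD i (lift i j) (neq_lift _ _); have kE := DD i (lift i k) (neq_lift _ _).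
  have [<-|jk] := eqVneq j k.
    move: jE; rewrite dotv_subC !ler_norml /= => /andP[? ?].
    by apply/andP; split; lra.
  have jkE := DD (lift i j) (lift i k).
  rewrite (inj_eq (@lift_inj _ _)) in jkE; have {}jkE := jkE jk.
  have -> : dotv (p (lift i j) - p i) (p (lift i k) - p i) =
     (dotv (p i - p (lift i j)) (p i - p (lift i j)) + dotv (p i - p (lift i k)) (p i - p (lift i k))
      - dotv (p (lift i j) - p (lift i k)) (p (lift i j) - p (lift i k))) / 2.
    rewrite !dotvE (dotvC (p (lift i k)) (p (lift i j))) (dotvC (p (lift i k)) (p i)) (dotvC (p (lift i j)) (p i)).
    by field.
  move: jE kE jkE; rewrite !ler_norml /= => /andP[? ?] /andP[? ?] /andP[? ?].
  by apply/andP; split; lra.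
- move=> j; rewrite /b -(opprB (p i) (p (lift i j))) dotvNr normrN ler_norml.
  have := up i (lift i j) (neq_lift _ _); have := lo (lift i j) (neq_lift _ _) => ? ?.
  by apply/andP; split; lra.
move=> h; apply: le_trans h _.
have : 0 <= (N ^+ 2 - (N - 1)) * (8 * N ^+ 2 * e) ^+ 2.
  apply: mulr_ge0; last exact: sqr_ge0.
  have : N * (N - 1) >= 0 by apply: mulr_ge0; lra.
  lra.
lra.
Qed.

End NearlyRegular.

(** * The reconstructor that refines a finite list of reference simplices *)

Section Reconstructor.
Variables (R : realType) (d : nat).
Hypothesis d0 : (0 < d)%N.
Implicit Types (K : 'rV[R]_d -> Prop) (p q : 'I_d.+1 -> 'rV[R]_d) (eta : R).

Let N : R := d.+1%:R.
Let jung2 : R := jung2 R d.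

(* Only the simplices of circumradius above Jung's bound for diameter 2
   matter for the excess error. *)
Definition excessive K q :=
  (forall i, K (q i)) /\ exists2 mu, weights mu & jung2 < wvariance mu q.

Definition near_simplex eta p q :=
  forall i, dotv (q i - p i) (q i - p i) <= eta ^+ 2.

Definition located (S : Type) K (z : S -> 'I_d.+1 -> 'rV[R]_d) eta :=
  forall q, excessive K q -> exists s, near_simplex eta (z s) q.

(** Defined on the zero vector too, so that the degenerate edges with [i = j] need no separate
    treatment. *)
Lemma exists_direction : exists f : 'rV[R]_d -> 'rV[R]_d,
  forall x, dotv (f x) (f x) = 1 /\ exists a, x = a *: f x.
Proof.
suff h (x : 'rV[R]_d) : exists v, dotv v v = 1 /\ exists a, x = a *: v.
  by have [f hf] := choice h; exists f.
have [->|/normalize_unit[v v1 [a _ xE]]] := eqVneq x 0.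
  have [v v1] := exists_unit R d0.
  by exists v; split=> //; exists 0; rewrite scale0r.
by exists v; split=> //; exists a.
Qed.

Definition edges (S : finType) (z : S -> 'I_d.+1 -> 'rV[R]_d) :=
  [seq z t.1 t.2.1 - z t.1 t.2.2 | t : S * ('I_d.+1 * 'I_d.+1)].

Lemma size_edges (S : finType) (z : S -> 'I_d.+1 -> 'rV[R]_d) :
  size (edges z) = (#|S| * (d.+1 * d.+1))%N.
Proof. by rewrite size_map -cardE !card_prod card_ord. Qed.

Lemma edge_mem (S : finType) (z : S -> 'I_d.+1 -> 'rV[R]_d) s i j :
  z s i - z s j \in edges z.
Proof. by apply/mapP; exists (s, (i, j)); rewrite ?mem_enum. Qed.

(** * One phase: the effect of querying all reference edges *)

Section Phase.
Variables (S : finType) (f : 'rV[R]_d -> 'rV[R]_d).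
Hypothesis fP : forall x, dotv (f x) (f x) = 1 /\ exists a, x = a *: f x.
Variables (K K' : 'rV[R]_d -> Prop) (z : S -> 'I_d.+1 -> 'rV[R]_d) (eta : R).
Hypothesis zK : located K z eta.
Hypothesis K'K : forall x, K' x -> K x.
Hypothesis width : forall v x y,
  v \in map f (edges z) -> K' x -> K' y -> `|dotv (x - y) v| <= 2.

Lemma excessive_sub q : excessive K' q -> excessive K q.
Proof. by case=> Kq hq; split=> // i; exact: K'K. Qed.

(* The component of [p i - q j] along the queried edge is at most 2, and the
   transversal one at most [2 eta]. *)
Lemma located_dist s p q i j : K' (p i) -> K' (q j) ->
  near_simplex eta (z s) p -> near_simplex eta (z s) q ->
  dotv (p i - q j) (p i - q j) <= 4 + 4 * eta ^+ 2.
Proof.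
move=> Kp Kq /(_ i) np /(_ j) nq.
have [u1 [a aE]] := fP (z s i - z s j).
set u := f _ in u1 aE.
have := width (map_f f (edge_mem z s i j)) Kp Kq; rewrite -/u.
set x := p i - q j => xu.
have xu2 : dotv x u ^+ 2 <= 2 ^+ 2.
  by rewrite -(real_normK (num_real _)) ler_sqr ?nnegrE.
have := dotv_sqrB_le (p i - z s i) (q j - z s j).
have -> : p i - z s i - (q j - z s j) = x - a *: u.
  by rewrite -aE /x; apply/rowP => k; rewrite !mxE; ring.
have -> : dotv (x - a *: u) (x - a *: u) = dotv x x - 2 * a * dotv x u + a ^+ 2.
  rewrite dotvDl 2!dotvDr !dotvNl !dotvNr !dotvZl !dotvZr (dotvC u x) u1; ring.
have := sqr_ge0 (a - dotv x u); lra.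
Qed.

Lemma excessive_dist q : excessive K' q -> forall i j,
  dotv (q i - q j) (q i - q j) <= 4 + 4 * eta ^+ 2.
Proof.
move=> hq i j; have [s zs] := zK (excessive_sub hq).
by apply: (located_dist (s := s)) => //; exact: hq.1.
Qed.

(** Each reference is replaced by a surviving excessive simplex near it, if there is one. Any other
    survivor near the same reference is then close by [nearly_regular_close] with
    [e = 4 * eta ^+ 2]. *)
Lemma located_refine : 32 * N ^+ 3 * eta ^+ 2 <= 1 ->
  exists z' : S -> _, located K' z' (32 * N ^+ 3 * eta ^+ 2).
Proof.
move=> small.
have N1 : 1 <= N by rewrite ler1n.
have e0 : 0 <= 4 * eta ^+ 2 by have := sqr_ge0 eta; lra.
have small1 : N ^+ 2 * (4 * eta ^+ 2) <= 1.
  have : 0 <= N ^+ 2 * (4 * eta ^+ 2) * (8 * N - 1).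
    apply: mulr_ge0; last lra.
    by apply: mulr_ge0 => //; exact: sqr_ge0.
  lra.
have small2 : 8 * N ^+ 3 * (4 * eta ^+ 2) <= 1 by lra.
have pick s : exists p', forall p, excessive K' p -> near_simplex eta (z s) p ->
    excessive K' p' /\ near_simplex eta (z s) p'.
  have [[p [hp np]]|no] := pselect (exists p, excessive K' p /\ near_simplex eta (z s) p).
    by exists p.
  by exists (z s) => p hp np; case: no; exists p.
have [z' hz'] := choice pick.
exists z' => q hq; have [s zs] := zK (excessive_sub hq).
have [hp np] := hz' s q hq zs; exists s.
have regular r : excessive K' r -> forall i j, i != j ->
    4 - 4 * N ^+ 2 * (4 * eta ^+ 2) <= dotv (r i - r j) (r i - r j).
  move=> hr; have [_ [mu muw var]] := hr.
  by apply: (nearly_regular muw var) => // i j _; exact: excessive_dist.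
move=> i; have -> : 32 * N ^+ 3 * eta ^+ 2 = 8 * N ^+ 3 * (4 * eta ^+ 2) by ring.
apply: (nearly_regular_close d0) => //.
- by move=> a b _; exact: excessive_dist.
- by move=> a b _; apply: (located_dist (s := s)) => //; [exact: hq.1 | exact: hp.1].
- exact: regular.
- exact: regular.
- move=> a; have := dotv_sqrB_le (q a - z s a) (z' s a - z s a).
  have -> : q a - z s a - (z' s a - z s a) = q a - z' s a.
    by apply/rowP => k; rewrite !mxE; ring.
  have := zs a; have := np a; lra.
Qed.

(** A configuration either is not excessive or has squared diameter at most [4 + 4 * eta ^+ 2], so
    its variance is at most [jung2 * (1 + eta ^+ 2)]. The slack [jung2 * eta ^+ 2] in
    [variance_center] fits since [1 + 2 * eta ^+ 2 <= (1 + eta ^+ 2) ^+ 2]. *)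
Lemma located_center : 0 < eta ->
  exists c, forall x, K' x -> eucl (c - x) <= Num.sqrt jung2 * (1 + eta ^+ 2).
Proof.
move=> etap.
have N0 : 0 < N by rewrite ltr0n.
have j0 : 0 < jung2 by rewrite divr_gt0 // mulr_gt0 // ltr0n.
have e2 : 0 < eta ^+ 2 by rewrite exprn_gt0.
have je : 0 < jung2 * eta ^+ 2 by exact: mulr_gt0.
have [c hc] : exists c, forall x, K' x ->
    dotv (c - x) (c - x) <= jung2 * (1 + eta ^+ 2) + jung2 * eta ^+ 2.
  apply: variance_center => // mu q muw Kq.
  have [h|h] := leP (wvariance mu q) jung2; first lra.
  have := @variance_le_diam _ _ mu q (4 + 4 * eta ^+ 2) muw _ _.
  rewrite -/jung2 => hv; suff : wvariance mu q <= jung2 * (4 + 4 * eta ^+ 2) / 4 by lra.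
  apply: hv; first lra.
  by move=> i j _; apply: excessive_dist; split=> //; exists mu.
exists c => x /hc h; rewrite eucl_le; last first.
  by apply: mulr_ge0; rewrite ?sqrtr_ge0 //; lra.
apply: le_trans h _; rewrite exprMn sqr_sqrtr ?(ltW j0) //.
have := mulr_ge0 (ltW j0) (sqr_ge0 (eta ^+ 2)); lra.
Qed.

End Phase.

Definition refine_radius eta : R := 32 * N ^+ 3 * eta ^+ 2.

(** The index type [S] is the same in all phases, so each costs the same number of queries: [k]
    phases refine and a last one yields the centre. *)
Lemma win_phases (S : finType) k K (z : S -> 'I_d.+1 -> 'rV[R]_d) eta :
  0 < eta -> eta <= 1 -> 32 * N ^+ 3 * eta <= 1 -> located K z eta ->
  win 1 (Num.sqrt jung2 * (1 + iter k refine_radius eta ^+ 2))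
    (k.+1 * (#|S| * (d.+1 * d.+1))) K.
Proof.
have [f fP] := exists_direction.
elim: k K z eta => [|k IH] K z eta etap eta1 small zK.
  rewrite mul1n -(size_edges z) -(size_map f) -[X in win _ _ X]addn0.
  apply: win_queries => [_ /mapP[x _ ->]|K' K'K width]; first by have [] := fP x.
  rewrite mulr1 in width.
  exact: (located_center fP zK K'K width).
rewrite mulSn -{1}(size_edges z) -(size_map f).
apply: win_queries => [_ /mapP[x _ ->]|K' K'K width]; first by have [] := fP x.
rewrite mulr1 in width.
have N0 : 0 < 32 * N ^+ 3 by rewrite mulr_gt0 // exprn_gt0 // ltr0n.
have c_le : refine_radius eta <= eta.
  have -> : refine_radius eta = 32 * N ^+ 3 * eta * eta by rewrite /refine_radius; ring.
  by rewrite ler_piMl // ltW.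
have c_gt0 : 0 < refine_radius eta by rewrite mulr_gt0 // exprn_gt0.
have [z' z'K] : exists z' : S -> _, located K' z' (refine_radius eta).
  apply: (located_refine fP zK K'K width); rewrite -/(refine_radius eta); lra.
rewrite iterSr; apply: (IH _ z') => //; first lra.
by apply: le_trans small; rewrite ler_pM2l.
Qed.

Lemma grid_cell n (y : R) : (0 < n)%N -> 0 <= y <= n%:R ->
  exists k : 'I_n, `|y - k%:R| <= 1.
Proof.
move=> n0 /andP[y0 yn].
suff [k kn hk] : exists2 k, (k < n)%N & `|y - k%:R| <= 1 by exists (Ordinal kn).
elim: n n0 yn => // n IH _ yn.
have [yn'|yn'] := leP y n%:R.
  case: n IH yn yn' => [|n] IH yn yn'; last first.
    have [//|k kn hk] := IH _ yn'; by exists k => //; rewrite ltnS ltnW.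
  exists 0%N => //; rewrite ler_norml; apply/andP; split; lra.
exists n => //; rewrite ler_norml -addn1 natrD in yn *; apply/andP; split; lra.
Qed.

(* After querying the coordinate axes the secret lies in a box, which finitely
   many points cover up to [eta]; the candidate simplices are all the tuples
   of those points. *)
Lemma win_upper_bound eta : 0 < eta -> eta <= 1 -> 32 * N ^+ 3 * eta <= 1 ->
  exists2 Q, (0 < Q)%N & forall k,
    win 1 (Num.sqrt jung2 * (1 + iter k refine_radius eta ^+ 2)) (d + k.+1 * Q)
      (fun _ : 'rV[R]_d => True).
Proof.
move=> etap eta1 small.
(* The box has side 4 and is cut into [n] cells per axis, so a point is within [4 * d / n <= eta] of
   the grid. *)
have [n n0 hn] : exists2 n, (0 < n)%N & 4 * d%:R <= n%:R * eta.
  exists (Num.truncn (4 * d%:R / eta)).+1 => //.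
  rewrite -ler_pdivrMr // ltW // truncnS_gt //.
have nR : 0 < n%:R :> R by rewrite ltr0n.
pose S : finType := {ffun 'I_d.+1 -> {ffun 'I_d -> 'I_n}}.
exists (#|S| * (d.+1 * d.+1))%N.
  rewrite muln_gt0 andbT; apply/card_gt0P.
  by exists [ffun=> [ffun=> Ordinal n0]].
move=> k.
pose vs : seq 'rV[R]_d := [seq delta_mx 0 i | i : 'I_d].
rewrite -[X in win _ _ (X + _)](_ : size vs = d); last by rewrite size_map -cardE card_ord.
apply: win_queries => [_ /mapP[i _ ->]|K _ width]; first by rewrite dotv_delta mxE !eqxx.
have {}width x y i : K x -> K y -> `|(x - y) 0 i| <= 2.
  move=> Kx Ky; rewrite -dotv_delta -[2]mulr1; apply: width => //.
  by apply: map_f; rewrite mem_enum.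
have [[x0 Kx0]|K0] := pselect (exists x, K x); last first.
  apply: (@win_phases S k K (fun _ _ => 0)) => // q [Kq _].
  by case: K0; exists (q ord0).
pose g (t : {ffun 'I_d -> 'I_n}) : 'rV[R]_d :=
  x0 + \row_i (4 / n%:R * (t i)%:R - 2).
have cover x : K x -> exists t, dotv (x - g t) (x - g t) <= eta ^+ 2.
  move=> Kx.
  have cell i : exists m : 'I_n, `|((x - x0) 0 i + 2) * (n%:R / 4) - m%:R| <= 1.
    apply: grid_cell => //; have := width x x0 i Kx Kx0.
    rewrite ler_norml => /andP[h1 h2]; apply/andP; split.
      by apply: mulr_ge0; lra.
    rewrite mulrA ler_pdivrMr // mulrC ler_pM2l //; lra.
  have [t ht] := choice cell.
  exists [ffun i => t i].
  have h i : (x - g [ffun i => t i]) 0 i ^+ 2 <= (4 / n%:R) ^+ 2.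
    have -> : (x - g [ffun i => t i]) 0 i =
        4 / n%:R * (((x - x0) 0 i + 2) * (n%:R / 4) - (t i)%:R).
      by rewrite /g !mxE ffunE; field; rewrite gt_eqF.
    rewrite exprMn ler_piMr ?sqr_ge0 // -(real_normK (num_real _)).
    by rewrite expr_le1.
  apply: (@le_trans _ _ (\sum_(i < d) (4 / n%:R) ^+ 2)).
    by apply: ler_sum => i _; rewrite -expr2; exact: h.
  rewrite sumr_const card_ord -[_ *+ d]mulr_natl.
  have d1 : 1 <= d%:R :> R by rewrite ler1n.
  have : (4 * d%:R / n%:R) ^+ 2 <= eta ^+ 2.
    rewrite ler_sqr ?nnegrE ?(ltW etap) //.
    by rewrite ler_pdivrMr // [leRHS]mulrC.
  have : 0 <= (4 / n%:R : R) ^+ 2 * (d%:R * (d%:R - 1)).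
    by apply: mulr_ge0; [exact: sqr_ge0 | apply: mulr_ge0; lra].
  have -> : (4 * d%:R / n%:R) ^+ 2 = (4 / n%:R) ^+ 2 * (d%:R * d%:R) :> R by ring.
  lra.
apply: (@win_phases S k K (fun s i => g (s i))) => // q [Kq _].
have [t ht] := choice (fun i => cover _ (Kq i)).
by exists [ffun i => t i] => i; rewrite ffunE.
Qed.

End Reconstructor.

(** * Rates *)

Section OptimalError.
Variables (R : realType) (d : nat).
Hypothesis d2 : (2 <= d)%N.

Let d0 : (0 < d)%N := ltnW d2.
Let J : R := Num.sqrt (jung2 R d).

Let jung2_gt0 : 0 < jung2 R d.
Proof. by rewrite divr_gt0 ?mulr_gt0 ?ltr0n. Qed.

Let J2 : J ^+ 2 = jung2 R d.
Proof. by rewrite sqr_sqrtr // ltW. Qed.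

Lemma jung_bounds : 1 <= J <= 2.
Proof.
have N0 : 0 < d.+1%:R :> R by rewrite ltr0n.
have d2R : 2 <= d%:R :> R by rewrite ler_nat.
have dN : d.+1%:R = d%:R + 1 :> R by rewrite -addn1 natrD.
apply/andP; split.
  rewrite -[leLHS]sqrtr1 ler_wsqrtr // ler_pdivlMr // dN; lra.
rewrite -(ger0_norm (ler0n R 2)) -sqrtr_sqr ler_wsqrtr //.
rewrite ler_pdivrMr // dN; lra.
Qed.

Lemma OPT_ge (delta : R) T : 0 < delta ->
  ((delta * (J + 512 ^- (2 ^ T)))%:E <= OPT d T delta)%E.
Proof.
move=> delta0; have /andP[J1 _] := jung_bounds.
pose g (e : R) := e ^+ 2 / 512.
(* Dividing by 512, the fixed point of [g], turns the iteration into squaring. *)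
have iterE n : iter n g 1 = 512 * 512 ^- (2 ^ n).
  elim: n => [|n IH]; first by rewrite /= expn0 expr1 divff ?pnatr_eq0.
  rewrite iterS IH /g expnS mulnC exprM.
  by field; rewrite expf_neq0 ?pnatr_eq0.
have := @iter_scale_bounds R T 1; rewrite -/g => /(_ _)/wrap[].
  by rewrite ltr01 lexx.
move=> /andP[e0 e1].
have [p pl] := @exists_simplex R d d2 (2 + iter T g 1) ltac:(apply/andP; split; lra).
rewrite leNgt; apply/negP => /(win_OPT_lt (ltW delta0)) h0.
have di : 0 < delta^-1 by rewrite invr_gt0.
have := win_scale di (K' := fun=> True) (fun _ _ => I) h0.
rewrite mulVf ?gt_eqF // mulKf ?gt_eqF //.
move=> h; have [] := @win_lower_bound _ _ d2 _ _ 1 (2 + iter T g 1) _ p _ _ _ pl _ h => //.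
- by rewrite ltr01 lexx.
- lra.
rewrite iterE in e0 *.
set u := 512 ^- (2 ^ T) in e0 *; rewrite -/(jung2 R d) -J2 => r0 r2.
have u0 : 0 < u by lra.
rewrite -exprMn ler_sqr ?nnegrE // in r2; last by apply: mulr_ge0; lra.
clearbody u.
have : 0 <= (J - 1) * u by apply: mulr_ge0; lra.
lra.
Qed.

Lemma OPT_le_powR : exists Q, (0 < Q)%N /\ forall (delta : R) k T,
  0 < delta -> (d + k.+1 * Q <= T)%N ->
  (OPT d T delta <= (delta * (J + 2 `^ (- 2 `^ k%:R)))%:E)%E.
Proof.
have /andP[J1 J2'] := jung_bounds.
pose C : R := 32 * d.+1%:R ^+ 3.
have C1 : 1 <= C.
  have : 1 <= d.+1%:R ^+ 3 :> R by rewrite exprn_ege1 // ler1n.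
  by rewrite /C; lra.
have C0 : C != 0 by rewrite gt_eqF //; lra.
(* With [C * eta = 1 / 2], each phase squares [C * eta], giving [2 ^- (2 ^ k)] after [k] phases. *)
pose eta := 1 / (2 * C).
have Ceta : C * eta = 1 / 2 by rewrite /eta; field.
have eta0 : 0 < eta by rewrite divr_gt0 //; lra.
have eta1 : eta <= 1.
  rewrite ler_pdivrMr; lra.
have [Q Q0 hQ] := @win_upper_bound R d d0 eta eta0 eta1 ltac:(rewrite -/C; lra).
exists Q; split=> // delta k T delta0 kT.
have iterE n : C * iter n (@refine_radius R d) eta = 2 ^- (2 ^ n).
  elim: n => [|n IH]; first by rewrite /= Ceta expn0 expr1; lra.
  rewrite iterS /refine_radius -/C expnS mulnC exprM -exprVn -IH; ring.
apply: OPT_le_win => //.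
apply: (win_more d0 kT).
have := win_scale delta0 (K' := fun=> True) (fun _ _ => I) (hQ k).
rewrite mulr1; apply: win_le.
rewrite (ler_pM2l delta0) mulrDr mulr1 lerD2l.
rewrite powR_mulrn ?ler0n // -natrX powR_invn ?ler0n //.
have := iterE k; set e := iter k _ _; set u := 2 ^- _ => eu.
have u01 : 0 < u <= 1 by rewrite invr_gt0 exprn_gt0 //= invf_le1 ?exprn_gt0 ?exprn_ege1 ?ler1n.
have /andP[u0 u1] := u01.
have u2 : u <= 1 / 2.
  rewrite div1r lef_pV2 ?posrE ?exprn_gt0 //.
  by rewrite -[leLHS]expr1 ler_weXn2l ?ler1n // expn_gt0.
have e0 : 0 <= e.
  by rewrite -(pmulr_rge0 _ (lt_le_trans ltr01 C1)) eu ltW.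
have eu' : e <= u by rewrite -eu ler_peMl.
have : e ^+ 2 <= u ^+ 2 by rewrite ler_sqr ?nnegrE // ltW.
have : 0 <= u * (1 / 2 - u) by apply: mulr_ge0; lra.
have : 0 <= (2 - J) * e ^+ 2 by apply: mulr_ge0; [lra | exact: sqr_ge0].
rewrite -/J; lra.
Qed.

Lemma OPT_le_rate : exists a : R, 0 < a /\ exists T' : nat,
  forall (delta : R) T, 0 < delta -> (T' < T)%N ->
  (OPT d T delta <= (delta * (J + 2 `^ (- 2 `^ (a * T%:R))))%:E)%E.
Proof.
have [Q [Q0 hQ]] := OPT_le_powR.
have QR : 0 < Q%:R :> R by rewrite ltr0n.
(* Half of the rounds suffice for about [T / (2 * Q)] phases of cost [Q]; the threshold
   [2 * d + 4 * Q] pays for the axis queries and the rounding. *)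
exists (1 / (2 * Q%:R)); split; first by rewrite divr_gt0 // mulr_gt0.
exists (2 * d + 4 * Q)%N => delta T delta0 T'T.
have := divn_eq T (2 * Q); have : (T %% (2 * Q) < 2 * Q)%N by rewrite ltn_pmod // muln_gt0.
move: (T %/ (2 * Q))%N (T %% (2 * Q))%N => m r rQ TE; pose k := m.+1.
apply: le_trans (hQ delta k T delta0 _) _.
  by rewrite /k; nia.
rewrite lee_fin (ler_pM2l delta0) lerD2l ler_powR ?ler1n // lerN2.
rewrite ler_powR ?ler1n // mul1r mulrC ler_pdivrMr ?mulr_gt0 //.
rewrite -natrM -natrM ler_nat /k; nia.
Qed.

(** Squeeze between the two bounds on [OPT], with the doubly exponential term dominated by a
    geometric sequence through [1 + x <= expR x]. *)
Lemma OPT_inf_jung (delta : R) : 0 < delta -> OPT_inf d delta = (delta * J)%:E.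
Proof.
move=> delta0; have [a [a0 [T' hT']]] := OPT_le_rate.
have l0 : 0 < ln 2 :> R by rewrite ln_gt0 // ltr1n.
have powE (x : R) : 2 `^ x = expR (x * ln 2) by rewrite /powR pnatr_eq0.
pose z := expR (- (a * ln 2 * ln 2)).
have z1 : `|z| < 1.
  by rewrite ger0_norm ?expR_ge0 // expR_lt1 oppr_lt0 !mulr_gt0.
have rate T : 2 `^ (- 2 `^ (a * T%:R)) <= z ^+ T.
  rewrite powE -expRM_natl ler_expR mulNr mulrN lerN2.
  have : a * T%:R * ln 2 <= 2 `^ (a * T%:R).
    by rewrite powE; apply: le_trans (expR_ge1Dx _); rewrite lerDr.
  by move=> /(ler_wpM2r (ltW l0)); apply: le_trans; rewrite le_eqVlt; apply/orP; left; apply/eqP; ring.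
apply: cvg_lim => //.
apply: (@squeeze_cvge _ _ _ _ (fun=> (delta * J)%:E) _
  (fun T => (delta * (J + z ^+ T))%:E)).
- near=> T; apply/andP; split.
    apply: le_trans (OPT_ge T delta0).
    rewrite lee_fin (ler_pM2l delta0) lerDl invr_ge0.
    by apply: exprn_ge0; exact: ler0n.
  apply: le_trans (hT' delta T delta0 _) _; first by near: T; exact: nbhs_infty_gt.
  by rewrite lee_fin (ler_pM2l delta0) lerD2l.
- exact: cvg_cst.
- apply: cvg_EFin; first exact: nearW.
  have h : ((delta * (J + z ^+ T)) @[T --> \oo] --> delta * (J + 0))%classic.
    apply: cvgMl_tmp; apply: cvgD; first exact: cvg_cst.
    exact: cvg_expr.
  by rewrite addr0 in h.
Unshelve. all: by end_near.
Qed.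

Lemma excess_err_rates : exists a A : R, 0 < a /\ 0 < A /\
  exists T' : nat, forall delta : R, 0 < delta -> forall T : nat, (T' < T)%N ->
    ((delta * 2 `^ (- 2 `^ (A * T%:R)))%:E <= ExcessErr d T delta /\
     ExcessErr d T delta <= (delta * 2 `^ (- 2 `^ (a * T%:R)))%:E)%E.
Proof.
have [a [a0 [T' hT']]] := OPT_le_rate.
(* The choice [A = 5] works because [512 = 2 ^ 9] and [9 * 2 ^ T <= 2 ^ (5 * T)] for [T >= 1], which
   [T' < T] guarantees. *)
exists a, 5; split=> //; split=> //; exists T' => delta delta0 T T'T.
rewrite /ExcessErr OPT_inf_jung //; split.
  rewrite leeBrDr // -EFinD; apply: le_trans (OPT_ge T delta0).
  rewrite lee_fin mulrDr addrC lerD2l (ler_pM2l delta0).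
  have -> : 512 = 2 ^+ 9 :> R by rewrite -natrX.
  rewrite -exprM -powR_invn // ler_powR ?ler1n // lerN2.
  rewrite -natrM powR_mulrn // -natrX ler_nat [(5 * T)%N]mulnC expnM.
  have T0 : (0 < T)%N by exact: leq_ltn_trans T'T.
  have -> : ((2 ^ T) ^ 5 = (2 ^ T) ^ 4 * 2 ^ T)%N by rewrite -expnSr.
  rewrite leq_mul2r; apply/orP; right.
  have : (2 ^ 1 <= 2 ^ T)%N by rewrite leq_exp2l.
  by rewrite -(@leq_exp2r _ _ 4) //; apply: leq_trans.
rewrite leeBlDr // -EFinD addrC -mulrDr; exact: hT'.
Qed.

End OptimalError.

Theorem theorem2 :
  forall (R : realType) (d : nat), (2 <= d)%N ->
  exists a A : R, 0 < a /\ 0 < A /\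
  exists T' : nat, forall (delta : R), 0 < delta ->
  forall T : nat, (T' < T)%N ->
    ((delta * 2 `^ (- 2 `^ (A * T%:R)))%:E <= ExcessErr d T delta /\
     ExcessErr d T delta <= (delta * 2 `^ (- 2 `^ (a * T%:R)))%:E)%E.
Proof. by move=> R d d2; exact: excess_err_rates. Qed.
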